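(* Let $n\ge 9$ be an integer, and let $h$ and $h'$ be the integers attached to $n$ as in the context. If $9\le n\le 16$, then $h'=h$. If $n\ge 17$, then $h'<h$.
   Context: For a nonnegative integer $k$ let $\alpha(k)$ be the number of $1$'s in the binary expansion of $k$ ($\alpha(0)=0$). The Hurwitz–Radon number $h$ of $n$ is defined by: $h=4\ell$ if $n=8\ell+1$; $h=4\ell+1$ if $n=8\ell+2$; $h=4\ell+2$ if $n=8\ell+3$ or $8\ell+4$; $h=4\ell+3$ if $n=8\ell+5$, $8\ell+6$, $8\ell+7$ or $8\ell+8$. The integer $h'$ is defined as follows. - $s$ is the integer with $2^{s-1}<n\le 2^s$. - If $n<2^s-2$, $t$ is the integer with $2^s-2^t-1\le n<2^s-2^{t-1}-1$; if $n\in\{2^s-2,2^s-1,2^s\}$, then $t=1$. - $D=\{k\in\mathbb{Z}\mid k\le n,\ 2^s-k+1\le n,\ \alpha(k-1)\ge 2,\ \alpha(2^s-k)\ge 2\}$. - If $D\ne\emptyset$, let $m=\max D$, $m'=2^{s-t}(2^s-m)+1$, and $\varepsilon=0$ if $m'>n$, $\varepsilon=1$ if $m'\le n$. - $h'=s$ if $D=\emptyset$, and $h'=2s-t+\varepsilon$ if $D\neq\emptyset$. *)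

(* Defs.v *)
From Stdlib Require Import ZArith Lia Classical.
Open Scope Z_scope.

Fixpoint pos_ones (p : positive) : Z :=
  match p with
  | xH => 1
  | xO q => pos_ones q
  | xI q => 1 + pos_ones q
  end.

(* Only nonnegative arguments matter: for n <= 2 ^ s, the inequalities in
   [setD] force k - 1 >= 0 and 2 ^ s - k >= 0. *)
Definition alpha (k : Z) : Z :=
  match k with
  | Zpos p => pos_ones p
  | _ => 0
  end.

Definition is_hurwitz_radon (n h : Z) : Prop :=
  exists l : Z,
       (n = 8 * l + 1 /\ h = 4 * l)
    \/ (n = 8 * l + 2 /\ h = 4 * l + 1)
    \/ ((n = 8 * l + 3 \/ n = 8 * l + 4) /\ h = 4 * l + 2)
    \/ ((n = 8 * l + 5 \/ n = 8 * l + 6 \/ n = 8 * l + 7 \/ n = 8 * l + 8)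
        /\ h = 4 * l + 3).

(* [Z.pow] is 0 at negative exponents; for n >= 2 the conditions below still
   force s >= 1 and t >= 1. *)
Definition is_s (n s : Z) : Prop := 2 ^ (s - 1) < n <= 2 ^ s.

Definition is_t (n s t : Z) : Prop :=
     (n < 2 ^ s - 2 /\ 2 ^ s - 2 ^ t - 1 <= n < 2 ^ s - 2 ^ (t - 1) - 1)
  \/ ((n = 2 ^ s - 2 \/ n = 2 ^ s - 1 \/ n = 2 ^ s) /\ t = 1).

Definition setD (n s k : Z) : Prop :=
  k <= n /\ 2 ^ s - k + 1 <= n /\ 2 <= alpha (k - 1) /\ 2 <= alpha (2 ^ s - k).

Definition is_max (A : Z -> Prop) (m : Z) : Prop :=
  A m /\ forall k : Z, A k -> k <= m.

Definition m_prime (s t m : Z) : Z := 2 ^ (s - t) * (2 ^ s - m) + 1.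

Definition epsilon (n s t m : Z) : Z := if m_prime s t m <=? n then 1 else 0.

Definition is_h_prime (n h' : Z) : Prop :=
  exists s t : Z, is_s n s /\ is_t n s t /\
    (  ((forall k : Z, ~ setD n s k) /\ h' = s)
    \/ (exists m : Z, is_max (setD n s) m /\ h' = 2 * s - t + epsilon n s t m)).

Lemma hurwitz_radon_exists (n : Z) : exists h, is_hurwitz_radon n h.
Proof.
pose proof (Z.div_mod (n - 1) 8 ltac:(lia)) as E.
pose proof (Z.mod_pos_bound (n - 1) 8 ltac:(lia)) as B.
set (l := (n - 1) / 8) in *. set (r := (n - 1) mod 8) in *.
assert (C : r = 0 \/ r = 1 \/ 2 <= r <= 3 \/ 4 <= r) by lia.
destruct C as [C|[C|[C|C]]];
  [exists (4*l) | exists (4*l+1) | exists (4*l+2) | exists (4*l+3)];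
  exists l; lia.
Qed.

Lemma hurwitz_radon_unique (n h1 h2 : Z) :
  is_hurwitz_radon n h1 -> is_hurwitz_radon n h2 -> h1 = h2.
Proof. intros [l1 H1] [l2 H2]; lia. Qed.

Lemma is_s_ge1 (n s : Z) : 2 <= n -> is_s n s -> 1 <= s.
Proof.
intros Hn [_ H]. destruct (Z.lt_ge_cases s 0) as [L|L].
- rewrite (Z.pow_neg_r 2 s L) in H; lia.
- destruct (Z.eq_dec s 0) as [->|]; [simpl in H|]; lia.
Qed.

Lemma is_s_exists (n : Z) : 2 <= n -> exists s, is_s n s.
Proof.
intros Hn. exists (Z.log2_up n). unfold is_s.
rewrite Z.sub_1_r. apply Z.log2_up_spec. lia.
Qed.

Lemma is_s_unique (n s1 s2 : Z) : 2 <= n -> is_s n s1 -> is_s n s2 -> s1 = s2.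
Proof.
intros Hn H1 H2.
pose proof (is_s_ge1 n s1 Hn H1). pose proof (is_s_ge1 n s2 Hn H2).
unfold is_s in *; rewrite !Z.sub_1_r in *.
rewrite <- (Z.log2_up_unique n s1), <- (Z.log2_up_unique n s2); lia.
Qed.

Lemma is_t_exists (n s : Z) : is_s n s -> exists t, is_t n s t.
Proof.
intros [_ H]. destruct (Z.lt_ge_cases n (2 ^ s - 2)) as [L|L].
- exists (Z.log2_up (2 ^ s - 1 - n)). left.
  pose proof (Z.log2_up_spec (2 ^ s - 1 - n) ltac:(lia)) as B.
  rewrite Z.sub_1_r. lia.
- exists 1. right. lia.
Qed.

Lemma is_t_unique (n s t1 t2 : Z) : is_t n s t1 -> is_t n s t2 -> t1 = t2.
Proof.
assert (P : forall t, n < 2 ^ s - 2 ->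
   2 ^ s - 2 ^ t - 1 <= n < 2 ^ s - 2 ^ (t - 1) - 1 ->
   t = Z.log2_up (2 ^ s - 1 - n)).
{ intros t L B. symmetry. rewrite Z.sub_1_r in B.
  destruct (Z.le_gt_cases t 0) as [N|N].
  - assert (2 ^ t <= 2 ^ 0) by (apply Z.pow_le_mono_r; lia).
    simpl in *; lia.
  - apply Z.log2_up_unique; lia. }
intros [[L1 B1]|[L1 ->]] [[L2 B2]|[L2 ->]]; try lia.
rewrite (P t1), (P t2); trivial.
Qed.

Lemma max_exists (A : Z -> Prop) (b k : Z) :
  (forall j, A j -> j <= b) -> A k -> exists m, is_max A m.
Proof.
intros Hb. remember (Z.to_nat (b - k)) as d eqn:Ed. revert k Ed.
induction d as [d IH] using lt_wf_ind. intros k Ed Hk.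
destruct (classic (exists j, A j /\ k < j)) as [[j [Hj L]]|N].
- pose proof (Hb j Hj). apply (IH (Z.to_nat (b - j))) with j; trivial; lia.
- exists k. split; trivial. intros j Hj.
  destruct (Z.le_gt_cases j k) as [|G]; trivial.
  exfalso; apply N; exists j; split; trivial; lia.
Qed.

Lemma h_prime_exists (n : Z) : 2 <= n -> exists h', is_h_prime n h'.
Proof.
intros Hn. destruct (is_s_exists n Hn) as [s Hs].
destruct (is_t_exists n s Hs) as [t Ht].
destruct (classic (exists k, setD n s k)) as [[k Hk]|N].
- destruct (max_exists (setD n s) n k) as [m Hm]; trivial.
  { intros j [Hj _]; exact Hj. }
  exists (2 * s - t + epsilon n s t m), s, t. repeat split; try apply Hs; trivial.
  right. exists m. split; trivial.
- exists s, s, t. repeat split; try apply Hs; trivial.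
  left. split; trivial. intros k Hk; apply N; exists k; exact Hk.
Qed.

Lemma h_prime_unique (n h1 h2 : Z) :
  2 <= n -> is_h_prime n h1 -> is_h_prime n h2 -> h1 = h2.
Proof.
intros Hn (s1 & t1 & Hs1 & Ht1 & C1) (s2 & t2 & Hs2 & Ht2 & C2).
pose proof (is_s_unique n s1 s2 Hn Hs1 Hs2); subst s2.
pose proof (is_t_unique n s1 t1 t2 Ht1 Ht2); subst t2.
destruct C1 as [[N1 ->]|[m1 [[A1 M1] ->]]];
destruct C2 as [[N2 ->]|[m2 [[A2 M2] ->]]]; trivial.
- destruct (N1 m2 A2).
- destruct (N2 m1 A1).
- pose proof (M1 m2 A2). pose proof (M2 m1 A1).
  replace m2 with m1 by lia. reflexivity.
Qed.

(* Main.v *)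
(** Every [h] satisfies [n <= 2 * h + 2], and [h' <= 2 * s - t + 1] because
    [t < s].  On the other hand [n] exceeds [2 ^ (s - 1)] and is at least
    [2 ^ s - 2 ^ t - 1]; once [s >= 5], the first bound when [t = s - 1] and
    the second when [t <= s - 2], combined with [2 ^ (s - 4) > s - 4], give
    [n > 2 * (2 * s - t + 1) + 2], hence [h > h'].

    For [9 <= n <= 16] we have [s = 4], and [D] consists of the elements of
    {4, 6, 7, 10, 11, 13} between [17 - n] and [n]; so [D] is empty for
    [n = 9], and otherwise [max D] is 10, 11 or 13 and [epsilon = 0]. *)

Require Import Defs.
From Stdlib Require Import ZArith Lia.
Open Scope Z_scope.

Lemma pow_lt_cancel_r (a b c : Z) : 0 < a -> a ^ b < a ^ c -> b < c.
Proof.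
intros Ha Hlt. destruct (Z.lt_ge_cases b c) as [|Hcb]; [assumption|].
pose proof (Z.pow_le_mono_r a c b Ha Hcb). lia.
Qed.

Lemma is_s_gt (n s b : Z) : is_s n s -> 2 ^ b < n -> b < s.
Proof. intros [_ Hn] Hb. apply (pow_lt_cancel_r 2); lia. Qed.

Lemma is_t_pos (n s t : Z) : is_t n s t -> 0 < t.
Proof.
intros [[Hn [Hlow _]] | [_ ->]]; [|lia].
apply (pow_lt_cancel_r 2); lia.
Qed.

Lemma is_t_lt_s (n s t : Z) : 3 <= n -> is_s n s -> is_t n s t -> t < s.
Proof.
intros Hn Hs Ht. pose proof (is_s_gt n s 1 Hs ltac:(lia)) as s_gt1.
destruct Ht as [[_ [_ Hup]] | [_ ->]]; [|exact s_gt1].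
assert (Hhalf : 2 ^ s = 2 * 2 ^ (s - 1)).
{ rewrite <- Z.pow_succ_r by lia. f_equal. lia. }
destruct Hs as [Hs _].
enough (t - 1 < s - 1) by lia.
apply (pow_lt_cancel_r 2); lia.
Qed.

Lemma is_t_lower (n s t : Z) : is_t n s t -> 2 ^ s - 2 ^ t - 1 <= n.
Proof. intros [[_ [Hlow _]] | [Hn ->]]; lia. Qed.

Lemma epsilon_le1 (n s t m : Z) : epsilon n s t m <= 1.
Proof. unfold epsilon. destruct (_ <=? _); lia. Qed.

Lemma epsilon_eq0 (n s t m : Z) : n < m_prime s t m -> epsilon n s t m = 0.
Proof. intros Hn. unfold epsilon. destruct (Z.leb_spec (m_prime s t m) n); lia. Qed.

Lemma h_prime_le (n s t h' : Z) :
  3 <= n -> is_s n s -> is_t n s t -> is_h_prime n h' -> h' <= 2 * s - t + 1.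
Proof.
intros Hn Hs Ht (s' & t' & Hs' & Ht' & Hh').
assert (s' = s) as -> by (apply (is_s_unique n); [lia | assumption ..]).
assert (t' = t) as -> by (apply (is_t_unique n s); assumption).
destruct Hh' as [[_ ->] | (m & _ & ->)].
- pose proof (is_t_lt_s n s t Hn Hs Ht). lia.
- pose proof (epsilon_le1 n s t m). lia.
Qed.

Lemma h_prime_bound_lt (n s t : Z) :
  17 <= n -> is_s n s -> is_t n s t -> 2 * (2 * s - t + 1) + 2 < n.
Proof.
intros Hn Hs Ht.
pose proof (is_s_gt n s 4 Hs ltac:(lia)) as s_gt4.
pose proof (is_t_pos n s t Ht) as t_pos.
pose proof (is_t_lt_s n s t ltac:(lia) Hs Ht) as t_lt_s.
pose proof (Z.pow_gt_lin_r 2 (s - 4) ltac:(lia) ltac:(lia)) as pow_gt_lin.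
assert (pow_split : forall i, 0 <= i -> 2 ^ (s - 4 + i) = 2 ^ (s - 4) * 2 ^ i).
{ intros i Hi. apply Z.pow_add_r; lia. }
destruct (Z.eq_dec t (s - 1)) as [-> | Hne].
- destruct Hs as [Hs _].
  replace (s - 1) with (s - 4 + 3) in Hs by lia.
  rewrite pow_split in Hs by lia. lia.
- pose proof (is_t_lower n s t Ht) as Hlow.
  pose proof (Z.pow_le_mono_r 2 t (s - 4 + 2) ltac:(lia) ltac:(lia)) as Hpow.
  replace s with (s - 4 + 4) in Hlow at 1 by lia.
  rewrite pow_split in Hlow, Hpow by lia. lia.
Qed.

Lemma hurwitz_radon_lower (n h : Z) : is_hurwitz_radon n h -> n <= 2 * h + 2.
Proof. intros [l Hl]. lia. Qed.

Lemma h_prime_lt_hurwitz_radon (n h h' : Z) :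
  17 <= n -> is_hurwitz_radon n h -> is_h_prime n h' -> h' < h.
Proof.
intros Hn Hh Hh'. destruct (Hh') as (s & t & Hs & Ht & _).
pose proof (hurwitz_radon_lower n h Hh).
pose proof (h_prime_le n s t h' ltac:(lia) Hs Ht Hh').
pose proof (h_prime_bound_lt n s t Hn Hs Ht). lia.
Qed.

Lemma is_t_s4 (n t : Z) :
  9 <= n -> is_s n 4 -> is_t n 4 t ->
  n <= 10 /\ t = 3 \/ 11 <= n <= 12 /\ t = 2 \/ 13 <= n /\ t = 1.
Proof.
intros Hn Hs Ht.
pose proof (is_t_pos n 4 t Ht). pose proof (is_t_lt_s n 4 t ltac:(lia) Hs Ht).
assert (t_cases : t = 1 \/ t = 2 \/ t = 3) by lia.
unfold is_t in Ht.
destruct t_cases as [-> | [-> | ->]]; simpl in Ht; lia.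
Qed.

Lemma setD_s4 (n k : Z) :
  n <= 16 ->
  setD n 4 k <->
  17 - n <= k <= n /\ (k = 4 \/ k = 6 \/ k = 7 \/ k = 10 \/ k = 11 \/ k = 13).
Proof.
intros Hn. unfold setD. change (2 ^ 4) with 16. split.
- intros (Hkn & Hnk & Hpred & Hcompl). split; [lia|].
  assert (k_cases : k = 1 \/ k = 2 \/ k = 3 \/ k = 5 \/ k = 8 \/ k = 9 \/
    k = 12 \/ k = 14 \/ k = 15 \/ k = 16 \/
    (k = 4 \/ k = 6 \/ k = 7 \/ k = 10 \/ k = 11 \/ k = 13)) by lia.
  repeat destruct k_cases as [-> | k_cases];
    simpl in Hpred, Hcompl; lia.
- intros [Hk k_cases].
  repeat destruct k_cases as [-> | k_cases]; try subst k; simpl; lia.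
Qed.

Lemma setD_s4_empty (n : Z) :
  9 <= n <= 16 -> (forall k, ~ setD n 4 k) -> n = 9.
Proof.
intros Hn Hempty. specialize (Hempty 10).
rewrite setD_s4 in Hempty by lia. lia.
Qed.

Lemma is_max_setD_s4 (n m : Z) :
  9 <= n <= 16 -> is_max (setD n 4) m ->
  n = 10 /\ m = 10 \/ 11 <= n <= 12 /\ m = 11 \/ 13 <= n /\ m = 13.
Proof.
intros Hn [Hm Hmax]. rewrite setD_s4 in Hm by lia.
pose proof (Hmax 10) as ge10. pose proof (Hmax 11) as ge11.
pose proof (Hmax 13) as ge13.
rewrite setD_s4 in ge10, ge11, ge13 by lia. lia.
Qed.

Lemma h_prime_eq_hurwitz_radon (n h h' : Z) :
  9 <= n <= 16 -> is_hurwitz_radon n h -> is_h_prime n h' -> h' = h.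
Proof.
intros Hn [l Hl] (s & t & Hs & Ht & Hh').
assert (Hs4 : is_s n 4) by (unfold is_s; simpl; lia).
assert (s = 4) as -> by (apply (is_s_unique n); [lia | assumption ..]).
destruct Hh' as [[Hempty ->] | (m & Hmax & ->)].
- pose proof (setD_s4_empty n Hn Hempty). lia.
- pose proof (is_t_s4 n t ltac:(lia) Hs4 Ht) as t_cases.
  destruct (is_max_setD_s4 n m Hn Hmax) as [[En ->] | [[En ->] | [En ->]]];
    [assert (t = 3) as -> by lia | assert (t = 2) as -> by lia
    | assert (t = 1) as -> by lia];
    rewrite epsilon_eq0; unfold m_prime; simpl; lia.
Qed.

Theorem proposition1p3 (n h h' : Z) (hn : 9 <= n)
  (Hh : is_hurwitz_radon n h) (Hh' : is_h_prime n h') :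
  (9 <= n <= 16 -> h' = h) /\ (17 <= n -> h' < h).
Proof.
split; intros Hn.
- exact (h_prime_eq_hurwitz_radon n h h' Hn Hh Hh').
- exact (h_prime_lt_hurwitz_radon n h h' Hn Hh Hh').
Qed.
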